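(* Let $F$ be a 4-regular graph. If $C$ and $C'$ are Euler systems of $F$, then, as matrices over $GF(2)$, $$M(C,C')=M(C',C)^{-1}.$$
   Context: Graphs. A graph has a finite vertex set and a finite edge set; loops and parallel edges are allowed. Each edge consists of two distinct half-edges, each incident on a vertex (for a non-loop edge the two half-edges are incident on different vertices; for a loop, on the same vertex). The degree of a vertex is the number of half-edges incident on it; a graph is 4-regular if every vertex has degree 4. $c(F)$ denotes the number of connected components of $F$. Circuits. A circuit is a closed sequence $v_1,h_1,h_1',v_2,\dots,v_k,h_k,h_k',v_{k+1}=v_1$ such that for each $i$, $h_i$ and $h_i'$ are the two half-edges of an edge $e_i$, the half-edges $h_i'$ and $h_{i+1}$ are incident on $v_{i+1}$ (indices cyclic), and $e_i\neq e_j$ for $i\neq j$. Circuits are considered up to choice of starting point and of orientation. An Euler circuit is a circuit in which every edge appears exactly once. An Euler system of $F$ is a collection of Euler circuits, one in each connected component of $F$. Transitions and circuit partitions. A transition at a vertex $v$ of a 4-regular graph is one of the three pairings of the four half-edges incident at $v$ into two disjoint pairs. A circuit partition of $F$ is a partition of $E(F)$ into edge-disjoint circuits; choosing one transition at each vertex determines a circuit partition, so circuit partitions correspond to systems of choices of one transition at each vertex. Say that $P$ involves the transition chosen for it at $v$. Euler systems are exactly the circuit partitions with $c(F)$ circuits. Labels. Given an Euler system $C$ and a vertex $v$, orient the circuit of $C$ incident on $v$ (either way), so that two of the half-edges at $v$ are incoming and two are outgoing. The transition at $v$ used by $C$ is labeled $\phi$ with respect to $C$; the other transition that pairs each incoming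 half-edge with an outgoing one is labeled $\chi$; the transition pairing the two incoming half-edges together and the two outgoing half-edges together is labeled $\psi$. Interlacement. $\mathcal I(C)$ is the simple graph with vertex set $V(F)$ in which distinct $v,w$ are adjacent if and only if they appear in the (cyclic) order $v\dots w\dots v\dots w\dots$ on one of the circuits of $C$. $\mathcal A(\mathcal I(C))$ is its $V(F)\times V(F)$ adjacency matrix over $GF(2)$ (zero diagonal). Modified interlacement matrix. For an Euler system $C$ and a circuit partition $P$ of $F$, $M(C,P)$ is the $V(F)\times V(F)$ matrix over $GF(2)$ obtained from $\mathcal A(\mathcal I(C))$ by the following changes: (1) for each vertex $v$ at which $P$ involves the $\phi$ transition with respect to $C$, change the diagonal entry corresponding to $v$ to $1$ and every other entry of the $v$ column to $0$; (2) for each vertex $v$ at which $P$ involves the $\psi$ transition with respect to $C$, change the diagonal entry corresponding to $v$ to $1$. Since Euler systems are circuit partitions, $M(C,C')$ and $M(C',C)$ are defined for Euler systems $C,C'$. *)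

(* Defs.v *)
From mathcomp Require Import all_boot all_order all_algebra.

Set Implicit Arguments.
Unset Strict Implicit.
Unset Printing Implicit Defensive.

Import GRing.Theory.
Local Open Scope ring_scope.

(* A finite graph, loops and parallel edges allowed, given by its half-edges:
   [opp h] is the other half of the edge containing [h], so the edges are the
   sets [{h, opp h}], and [h] is incident on the vertex [inc h]. *)
Record multigraph := Multigraph {
  vert : finType;
  halfedge : finType;
  opp : halfedge -> halfedge;
  inc : halfedge -> vert;
  oppK : involutive opp;
  opp_neq : forall h, opp h != h
}.

Section Graph.

Variable F : multigraph.
Implicit Types (v w : vert F) (h : halfedge F) (K : {set vert F}).
Implicit Types (c : seq (halfedge F)) (C P : seq (seq (halfedge F))).

Definition edge h : {set halfedge F} := [set h; opp h].

Definition half_at v : {set halfedge F} := [set h | inc h == v].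

Definition degree v : nat := #|half_at v|.

Definition four_regular : Prop := forall v, degree v = 4.

Definition adjacent : rel (vert F) :=
  fun v w => [exists h, (inc h == v) && (inc (opp h) == w)].

Definition components : {set {set vert F}} :=
  [set [set w | connect adjacent v w] | v : vert F].

(* The closed sequence v_1, h_1, h'_1, v_2, ..., v_k, h_k, h'_k, v_1 is
   recorded by [:: h_1; ...; h_k], as h'_i = opp h_i and v_i = inc h_i.
   A circuit, up to starting point and orientation, is handled through its
   representatives, related by [rot] and the reversal [c |-> rev (map opp c)]:
   reversing may exchange [incoming] and [outgoing] half-edges at a vertex, but
   transitions, labels and interlacement do not depend on representatives. *)
Definition circuit c : bool :=
  [&& c != [::],
      cycle (fun h1 h2 => inc (opp h1) == inc h2) c
    & uniq (map edge c)].

(* An Euler circuit of the component with vertex set [K]: it passes exactly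
   once along each edge of this component, and along no other edge. *)
Definition euler_circuit K c : bool :=
  circuit c &&
  [forall h, count_mem (edge h) (map edge c) == (inc h \in K)].

Definition euler_system C : bool :=
  all (fun c => [exists K in components, euler_circuit K c]) C
  && [forall K in components, count (euler_circuit K) C == 1%N].

Definition circuit_partition P : bool :=
  all circuit P && [forall h, count_mem (edge h) (map edge (flatten P)) == 1%N].

Lemma adjacent_sym : symmetric adjacent.
Proof.
move=> v w; apply/existsP/existsP => -[h /andP[h1 h2]];
by exists (opp h); rewrite oppK h1 h2.
Qed.

Lemma connect_component v K :
  K \in components -> v \in K -> K = [set w | connect adjacent v w].
Proof.
case/imsetP=> u _ -> ; rewrite inE => uv; apply/setP => w; rewrite !inE.
exact: (same_connect (sym_connect_sym adjacent_sym) uv).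
Qed.

Lemma euler_system_circuit_partition C :
  euler_system C -> circuit_partition C.
Proof.
case/andP=> /allP eC /forallP oneC; apply/andP; split.
  by apply/allP => c /eC /existsP[K /andP[_ /andP[]]].
apply/forallP => h.
pose K := [set w | connect adjacent (inc h) w].
have KP : K \in components by apply: imset_f.
have hK : inc h \in K by rewrite inE connect0.
have /implyP/(_ KP)/eqP <- := oneC K.
rewrite map_flatten count_flatten -!map_comp -sumn_count; apply/eqP.
congr sumn; apply/eq_in_map => c /eC /existsP[L /andP[LP ecL]] /=.
have /andP[_ /forallP/(_ h)/eqP ->] := ecL.
have [hL|hL] := boolP (inc h \in L).
  by rewrite -(connect_component LP hL : L = K) ecL.
apply/esym/eqP; rewrite eqb0; apply: contra hL => /andP[_ /forallP/(_ h)].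
have /andP[_ /forallP/(_ h)/eqP ->] := ecL.
by rewrite hK; case: (inc h \in L).
Qed.

(* The transition involved at [v]: a passage of a circuit through [v] pairs the
   half-edge [opp h] along which it arrives with the half-edge [next c h] along
   which it leaves. *)
Definition transition P v : {set {set halfedge F}} :=
  [set p | has (fun c =>
             has (fun h => (inc (next c h) == v)
                           && (p == [set opp h; next c h])) c) P].

(* Orientation of the circuits of [C] is that of the chosen representatives. *)
Definition outgoing C v : {set halfedge F} :=
  [set h in half_at v | h \in flatten C].

Definition incoming C v : {set halfedge F} :=
  [set h in half_at v | opp h \in flatten C].

Definition phi_transition C v : {set {set halfedge F}} := transition C v.

Definition psi_transition C v : {set {set halfedge F}} :=
  [set incoming C v; outgoing C v].

(* [v] and [w] appear in the cyclic order v ... w ... v ... w ... on [c]. *)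
Definition alternate c v w : bool :=
  [exists i : 'I_(size c), subseq [:: v; w; v; w] (rot i (map (@inc F) c))].

Definition interlaced C v w : bool :=
  (v != w) && has (fun c => alternate c v w) C.

(* V(F) x V(F) matrices are indexed through the enumeration of [vert F]. *)
Definition interlacement_mx C : 'M['F_2]_#|vert F| :=
  \matrix_(i, j) (interlaced C (enum_val i) (enum_val j))%:R.

Definition modified_interlacement_mx C P : 'M['F_2]_#|vert F| :=
  \matrix_(i, j)
    let w := enum_val j in
    if transition P w == phi_transition C w then (i == j)%:R
    else if (transition P w == psi_transition C w) && (i == j) then 1
    else interlacement_mx C i j.

End Graph.

(* Main.v *)
From mathcomp Require Import all_boot all_order all_algebra.
Require Import Defs.

Set Implicit Arguments.
Unset Strict Implicit.

Import GRing.Theory.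
Local Open Scope ring_scope.

(** Why the theorem holds.  A function from the half-edges to GF(2) that takes
    equal values on the two halves of each edge is a set of edges.  Such a set
    [z] jumps where a circuit passes from [h] to [next c h] if [z] contains
    exactly one of the two edges of this passage.

    An Euler system [C] cuts each of its circuits, at a vertex [v] on it, into
    two arcs.  Let [x_v] be the set of edges of one of these arcs.  At a vertex
    [w] other than [v], the arc uses one of the two passages of [C] if [w] is
    interlaced with [v], and both or none of them otherwise; at [v] it uses one
    incoming and one outgoing half-edge, paired by the chi transition.  Hence,
    along any circuit partition [P], the jump of [x_v] at [w] is the entry of
    M(C, P) at row [v] and column [w]: the three clauses in the definition of
    that matrix are the three transitions that [P] can involve at [w].  This is
    [arc_jump].

    In particular the sets [y_w] belonging to another Euler system [C'] have
    jumps along [C'] given by M(C', C') = 1.  So x_v + sum_w M(C, C')_vw y_w has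
    no jump along [C'] and is constant on the half-edges of each component
    ([no_jump_constant]).  It then has no jump along [P] either, and reading off
    its jumps along [P] gives M(C, P) = M(C, C') M(C', P)
    ([modified_interlacement_mx_mul]).  The theorem is the case P = C. *)

(** * Transitions of a circuit partition *)

Lemma uniq_flatten_inj (T : eqType) (ss : seq (seq T)) s t x :
  uniq (flatten ss) -> s \in ss -> t \in ss -> x \in s -> x \in t -> s = t.
Proof.
elim: ss => //= r ss IHss; rewrite cat_uniq => /and3P[_ /hasPn dis Uss].
have out u : u \in ss -> x \in u -> x \notin r.
  by move=> uss xu; apply: dis; apply/flattenP; exists u.
rewrite !inE => /predU1P[->|sss] /predU1P[->|tss] xs xt //.
- by case/negP: (out _ tss xt).
- by case/negP: (out _ sss xs).
- exact: IHss.
Qed.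

Section CircuitPartition.

Variable F : multigraph.
Implicit Types (v w : vert F) (a b h k : halfedge F).
Implicit Types (c s : seq (halfedge F)) (C P : seq (seq (halfedge F))).

Lemma edge_opp h : edge (opp h) = edge h.
Proof. by rewrite /edge oppK setUC. Qed.

Lemma edge_eqP h k : edge h = edge k -> k = h \/ k = opp h.
Proof. by move/setP/(_ k); rewrite !inE eqxx => /orP[]/eqP; [left|right]. Qed.

Lemma mem_map_edge h s :
  (edge h \in map (@edge F) s) = (h \in s) || (opp h \in s).
Proof.
apply/mapP/orP => [[k ks /edge_eqP[]<-]|[]hs]; [by left|by right| |].
  by exists h.
by exists (opp h); rewrite ?edge_opp.
Qed.

Section OnePartition.

Variable P : seq (seq (halfedge F)).
Hypothesis hP : circuit_partition P.

Lemma uniq_map_edge_flatten : uniq (map (@edge F) (flatten P)).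
Proof.
have /andP[_ /forallP cnt] := hP.
apply: count_mem_uniq => e; case: (boolP (e \in _)); last exact: count_memPn.
by case/mapP=> h _ ->; apply/eqP.
Qed.

Lemma uniq_flatten_partition : uniq (flatten P).
Proof. exact: map_uniq uniq_map_edge_flatten. Qed.

Lemma uniq_partition c : c \in P -> uniq c.
Proof.
have /andP[/allP Pc _] := hP; case/Pc/and3P=> _ _; exact: map_uniq.
Qed.

(** The edge of [h] occurs only once among the edges of the circuits, so only
    one of its two directions is used. *)
Lemma opp_flatten h : (opp h \in flatten P) = (h \notin flatten P).
Proof.
have hh : h \in flatten P -> opp h \notin flatten P.
  move=> hD; have := uniq_map_edge_flatten.
  rewrite (perm_uniq (perm_map (@edge F) (perm_to_rem hD))) /= mem_map_edge.
  rewrite (rem_filter _ uniq_flatten_partition) !mem_filter /= opp_neq.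
  by case/andP=> /norP[_].
case: (boolP (h \in flatten P)) => [/hh/negPf //|hD].
have /andP[_ /forallP/(_ h)/eqP cnt] := hP.
have : edge h \in map (@edge F) (flatten P) by rewrite -has_pred1 has_count cnt.
by rewrite mem_map_edge (negPf hD).
Qed.

Lemma inc_next c h : c \in P -> h \in c -> inc (next c h) = inc (opp h).
Proof.
have /andP[/allP Pc _] := hP; case/Pc/and3P=> _ cyc _ hc.
by apply/esym/eqP; exact: (next_cycle cyc).
Qed.

Lemma transitionP p v :
  reflect (exists c h, [/\ c \in P, h \in c, inc (next c h) = v
                         & p = [set opp h; next c h]])
          (p \in transition P v).
Proof.
rewrite inE; apply: (iffP hasP) => [[c cP /hasP[h hc /andP[/eqP vh /eqP ph]]]|].
  by exists c, h.
case=> c [h [cP hc vh ph]]; exists c => //; apply/hasP; exists h => //.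
by rewrite vh ph !eqxx.
Qed.

Lemma next_flatten c h : c \in P -> h \in c -> next c h \in flatten P.
Proof. by move=> cP hc; apply/flattenP; exists c; rewrite ?mem_next. Qed.

Lemma opp_notin_flatten c h : c \in P -> h \in c -> opp h \notin flatten P.
Proof. by move=> cP hc; rewrite -opp_flatten oppK; apply/flattenP; exists c. Qed.

Lemma passage_neq c h : c \in P -> h \in c -> opp h != next c h.
Proof.
move=> cP hc; apply: contraNneq (opp_notin_flatten cP hc) => ->.
exact: next_flatten cP hc.
Qed.

Lemma transition_sub p v : p \in transition P v -> p \subset half_at v.
Proof.
case/transitionP=> c [h [cP hc <- ->]]; apply/subsetP => k.
by rewrite !inE => /orP[]/eqP->; rewrite ?inc_next.
Qed.

Lemma card_transition p v : p \in transition P v -> #|p| = 2.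
Proof.
by case/transitionP=> c [h [cP hc _ ->]]; rewrite cards2 passage_neq.
Qed.

Lemma transition_cover v k : inc k = v -> exists2 p, p \in transition P v & k \in p.
Proof.
move=> kv; case: (boolP (k \in flatten P)) => [/flattenP[c cP kc]|].
  exists [set opp (prev c k); k]; rewrite ?set22 //; apply/transitionP.
  by exists c, (prev c k); rewrite mem_prev next_prev ?uniq_partition.
rewrite -opp_flatten => /flattenP[c cP kc].
exists [set k; next c (opp k)]; rewrite ?set21 //; apply/transitionP.
by exists c, (opp k); rewrite oppK inc_next // oppK.
Qed.

Lemma transition_meet p q v k :
  p \in transition P v -> q \in transition P v -> k \in p -> k \in q -> p = q.
Proof.
case/transitionP=> c [h [cP hc _ ->]] /transitionP[c' [h' [cP' hc' _ ->]]].
have UP := uniq_flatten_partition.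
have same x : x \in c -> x \in c' -> c = c' by exact: (uniq_flatten_inj UP).
rewrite !inE => /orP[]/eqP-> /orP[]/eqP hh.
- have eh : h = h' by apply: (can_inj (@oppK F)).
  by rewrite -eh in hc' *; rewrite (same h).
- by case/negP: (opp_notin_flatten cP hc); rewrite hh next_flatten.
- by case/negP: (opp_notin_flatten cP' hc'); rewrite -hh next_flatten.
have ec : c = c' by apply: (same (next c h)); rewrite ?mem_next // hh mem_next.
rewrite -ec in hc' hh *; congr [set opp _; _]; last by [].
exact: (can_inj (prev_next (uniq_partition cP))).
Qed.

(** At a vertex of degree 4, one of the two pairs of a transition determines
    the other; hence transitions sharing a pair are equal. *)
Lemma transition_pair p v : degree v = 4 ->
  p \in transition P v -> transition P v = [set p; half_at v :\: p].
Proof.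
move=> dv pP.
have cDp : #|half_at v :\: p| = 2.
  by rewrite cardsDS ?transition_sub // (card_transition pP) [#|_|]dv.
have other q : q \in transition P v -> q != p -> q = half_at v :\: p.
  move=> qP nqp; apply/eqP; rewrite eqEcard cDp (card_transition qP) leqnn andbT.
  rewrite subsetD transition_sub //= -setI_eq0.
  apply/set0Pn => -[k /setIP[kq kp]]; case/eqP: nqp.
  exact: (transition_meet qP pP kq kp).
apply/setP => q; rewrite in_set2; apply/idP/orP => [qP|[]/eqP-> //].
  by case: (eqVneq q p) => [|nqp]; [left|right; apply/eqP; exact: other].
have /set0Pn[k]: half_at v :\: p != set0 by rewrite -card_gt0 cDp.
rewrite 2!inE => /andP[kp /eqP kv]; have [r rP kr] := transition_cover kv.
by rewrite -(other r) //; apply: contraNneq kp => <-.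
Qed.

End OnePartition.

Lemma transition_eq P Q p v : degree v = 4 ->
  circuit_partition P -> circuit_partition Q ->
  p \in transition P v -> p \in transition Q v -> transition P v = transition Q v.
Proof.
by move=> dv hP hQ pP pQ; rewrite (transition_pair hP dv pP) (transition_pair hQ dv pQ).
Qed.

End CircuitPartition.

(** * Alternation on closed sequences *)

Section Alternation.

Variable T : eqType.
Implicit Types (v w : T) (s x y z : seq T).

Lemma subseq_skip v s x y :
  v \notin x -> subseq (v :: s) (x ++ y) = subseq (v :: s) y.
Proof.
elim: x => [|u x IHx] //=.
by rewrite inE negb_or => /andP[/negPf->]; exact: IHx.
Qed.

Lemma subseq_alternate v w x y z : v \notin x -> v \notin y -> v \notin z ->
  subseq [:: v; w; v; w] (x ++ v :: y ++ v :: z) -> w \in y /\ w \in z.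
Proof.
move=> vx vy vz; rewrite subseq_skip //= eqxx => sub; split.
  apply: contraNT vz => wy; move: sub; rewrite subseq_skip //=.
  by case: ifP => _ /mem_subseq-> //; rewrite !inE eqxx ?orbT.
have := subseq_trans (subseq_cons [:: v; w] w) sub.
by rewrite subseq_skip //= eqxx sub1seq.
Qed.

(** The two arcs between the occurrences of [v] on a closed sequence do not
    depend on where the sequence is cut open, so alternation can be read off
    from a sequence that starts at [v]. *)
Lemma alternate_rot v w n s1 s2 : v \notin s1 -> v \notin s2 ->
  subseq [:: v; w; v; w] (rot n (v :: s1 ++ v :: s2)) -> w \in s1 /\ w \in s2.
Proof.
have sub_notin m s : v \notin s -> v \notin take m s /\ v \notin drop m s.
  by rewrite -{1}(cat_take_drop m s) mem_cat negb_or => /andP.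
move=> vs1 vs2; rewrite -cat_cons /rot drop_cat take_cat.
case: ltnP => _; [|move: (n - _)%N => {}n]; case: n => [|n] /=.
- by rewrite cats0; exact: (@subseq_alternate v w [::]).
- have [vt vd] := sub_notin n _ vs1; rewrite -catA /=.
  by case/subseq_alternate => // ws2 /mem_take.
- by rewrite cats0; case/(@subseq_alternate v w [::]).
- have [vt vd] := sub_notin n _ vs2.
  by case/subseq_alternate => // ws1 /mem_take.
Qed.

End Alternation.

(** * The arcs of an Euler system *)

Lemma path_all_rel (T : eqType) (e : rel T) y t :
  (forall a b, a \in y :: t -> b \in t -> e a b) -> path e y t.
Proof.
elim: t y => //= z t IHt y eyz; rewrite eyz ?mem_head //=.
by apply: IHt => i j iz jt; apply: eyz; rewrite inE (iz, jt) orbT.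
Qed.

Section EulerSystem.

Variable F : multigraph.
Hypothesis hF : four_regular F.
Implicit Types (v w : vert F) (a b h k : halfedge F).
Implicit Types (c s : seq (halfedge F)).

Variable C : seq (seq (halfedge F)).
Hypothesis hC : euler_system C.

Let hP := euler_system_circuit_partition hC.

Lemma euler_incident c h k : c \in C -> inc h = inc k ->
  (edge h \in map (@edge F) c) = (edge k \in map (@edge F) c).
Proof.
have /andP[/allP eC _] := hC; case/eC/existsP=> K /and3P[_ _ /forallP cnt] hk.
by rewrite -!has_pred1 !has_count !(eqP (cnt _)) hk.
Qed.

Lemma mem_edge_circuit c h :
  c \in C -> h \in flatten C -> (edge h \in map (@edge F) c) = (h \in c).
Proof.
move=> cC hD; rewrite mem_map_edge; case: (h \in c) => //=.
apply: contraTF hD => ohc; rewrite -(opp_flatten hP).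
by apply/flattenP; exists c.
Qed.

(** Degree 4 leaves room for exactly two passages at [w]; they lie on the same
    circuit because an Euler circuit uses all the edges at a vertex it visits. *)
Lemma passages w : exists c h k,
  [/\ c \in C, h \in c, k \in c, h != k
    & [/\ half_at w = [set opp h; next c h] :|: [set opp k; next c k],
          transition C w = [set [set opp h; next c h]; [set opp k; next c k]],
          incoming C w = [set opp h; opp k]
        & outgoing C w = [set next c h; next c k]]].
Proof.
have dw := hF w; have /set0Pn[j]: half_at w != set0 by rewrite -card_gt0 [#|_|]dw.
rewrite inE => /eqP jw; have [p pC _] := transition_cover hP jw.
have tp := transition_pair hP dw pC.
have : half_at w :\: p \in transition C w by rewrite tp set22.
have sp := transition_sub hP pC.
case/transitionP: (pC) => c [h [cC hc hw ep]].
case/transitionP=> c' [k [cC' kc' kw eq]].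
have nD := next_flatten; have oD := opp_notin_flatten hP.
have nkc : next c' k \in c.
  rewrite -mem_edge_circuit ?nD // (euler_incident cC (etrans kw (esym hw))).
  by rewrite mem_edge_circuit ?nD // mem_next.
have ec : c' = c.
  have nkc' : next c' k \in c' by rewrite mem_next.
  exact: (uniq_flatten_inj (uniq_flatten_partition hP) cC' cC nkc').
rewrite {c' cC' nkc}ec in kc' kw eq *.
have eh : half_at w = [set opp h; next c h] :|: [set opp k; next c k].
  by rewrite -eq -ep -{1}(setID (half_at w) p) (setIidPr sp).
exists c, h, k; split=> //.
  apply/eqP => ehk; have := set21 (opp k) (next c k).
  by rewrite -eq ep -ehk !inE eqxx.
split=> //; first by rewrite tp eq ep.
  apply/setP => i; rewrite inE eh opp_flatten // !inE.
  case: (boolP (i \in flatten C)) => iD /=.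
    have ni l : l \in c -> (i == opp l) = false.
      by move=> lc; apply: contraTF iD => /eqP->; apply: oD lc.
    by rewrite andbF !ni.
  have ni l : l \in c -> (i == next c l) = false.
    by move=> lc; apply: contraNF iD => /eqP->; apply: nD lc.
  by rewrite andbT !ni ?orbF.
apply/setP => i; rewrite inE eh !inE.
case: (boolP (i \in flatten C)) => iD /=.
  have ni l : l \in c -> (i == opp l) = false.
    by move=> lc; apply: contraTF iD => /eqP->; apply: oD lc.
  by rewrite andbT !ni.
have ni l : l \in c -> (i == next c l) = false.
  by move=> lc; apply: contraNF iD => /eqP->; apply: nD lc.
by rewrite andbF !ni.
Qed.

Lemma outgoing_two a b k :
  a \in flatten C -> b \in flatten C -> k \in flatten C -> a != b ->
  inc b = inc a -> inc k = inc a -> k = a \/ k = b.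
Proof.
have [c [h [l [_ _ _ _ [_ _ _ eO]]]]] := passages (inc a).
have two j : j \in flatten C -> inc j = inc a -> j = next c h \/ j = next c l.
  move=> jD ja; suff: j \in outgoing C (inc a).
    by rewrite eO !inE => /orP[]/eqP; [left|right].
  by rewrite !inE ja eqxx jD.
move=> aD bD kD nab ba ka; move: nab.
case: (two a aD erefl) (two b bD ba) (two k kD ka) => -> [->|->] [->|->];
  rewrite ?eqxx //; by [left|right].
Qed.

Lemma arcs v : exists c n h1 h2 s1 s2,
  [/\ c \in C, rot n c = h1 :: s1 ++ h2 :: s2, inc h1 = v /\ inc h2 = v,
      v \notin map (@inc F) s1 /\ v \notin map (@inc F) s2
    & forall a, a \in flatten C -> inc a = v -> a = h1 \/ a = h2].
Proof.
have [c [h [k [cC hc kc nhk [_ _ _ eqO]]]]] := passages v.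
have Uc := uniq_partition hP cC.
have cD a : a \in c -> a \in flatten C by move=> ac; apply/flattenP; exists c.
have n12 : next c h != next c k by rewrite (can_eq (prev_next Uc)).
have m1 : next c h \in c by rewrite mem_next.
have m2 : next c k \in c by rewrite mem_next.
have [h1v h2v]: inc (next c h) = v /\ inc (next c k) = v.
  have iv a : a \in outgoing C v -> inc a = v by rewrite !inE => /andP[/eqP].
  by split; apply: iv; rewrite eqO !inE eqxx ?orbT.
move: (next c h) (next c k) h1v h2v n12 m1 m2 {eqO}.
move=> h1 h2 h1v h2v n12 m1 m2 {h k hc kc nhk}.
have cv a : a \in flatten C -> inc a = v -> a = h1 \/ a = h2.
  by move=> aD av; apply: outgoing_two; rewrite // ?h2v ?h1v // cD.
have [n s ec] := rot_to m1.
have h2s : h2 \in s by move: m2; rewrite -(mem_rot n) ec inE eq_sym (negPf n12).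
case/splitPr: h2s ec => s1 s2 ec.
have Ur : uniq (h1 :: s1 ++ h2 :: s2) by rewrite -ec rot_uniq.
have v12 : v \notin map (@inc F) (s1 ++ s2).
  apply/mapP => -[a as12 va].
  have ac : a \in c.
    by rewrite -(mem_rot n) ec -cat_cons mem_cat !inE orbACA -mem_cat as12 orbT.
  move: Ur; rewrite /= (uniq_catCA s1 [:: h2]) /= mem_cat inE orbCA -mem_cat.
  move=> /andP[/norP[_ n1] /andP[n2 _]].
  by case: (cv a (cD _ ac) (esym va)) as12 => ->; apply/negP.
exists c, n, h1, h2, s1, s2; split=> //.
by move: v12; rewrite map_cat mem_cat negb_or => /andP.
Qed.

Lemma interlaced_arcs v w c n h1 h2 s1 s2 :
  c \in C -> rot n c = h1 :: s1 ++ h2 :: s2 -> inc h1 = v -> inc h2 = v ->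
  v \notin map (@inc F) s1 -> v \notin map (@inc F) s2 ->
  (forall a, a \in flatten C -> inc a = v -> a = h1 \/ a = h2) -> v != w ->
  interlaced C v w = (w \in map (@inc F) s1) && (w \in map (@inc F) s2).
Proof.
move=> cC ec h1v h2v vs1 vs2 cv nvw; rewrite /interlaced nvw /=.
have m12 : h1 \in c /\ h2 \in c.
  by split; rewrite -(mem_rot n) ec ?mem_head // -cat_cons mem_cat mem_head orbT.
have em : rot n (map (@inc F) c) = v :: map (@inc F) s1 ++ v :: map (@inc F) s2.
  by rewrite -map_rot ec /= map_cat /= h1v h2v.
apply/hasP/andP => [[d dC /existsP[[i _] /= sub]]|[w1 w2]].
  have : v \in map (@inc F) d.
    by rewrite -(mem_rot i) (mem_subseq sub) ?mem_head.
  (* Both visits of [C] to [v] lie on [c], so no other circuit alternates. *)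
  case/mapP=> j jd vj; have jD : j \in flatten C by apply/flattenP; exists d.
  have jc : j \in c by case: m12; case: (cv j jD (esym vj)) => ->.
  have Ed := uniq_flatten_inj (uniq_flatten_partition hP) dC cC jd jc.
  move: sub; rewrite Ed -(rotK n (map _ c)) em /rotr rot_rot_add.
  by case/alternate_rot.
have sub : subseq [:: v; w; v; w] (rot n (map (@inc F) c)).
  rewrite em /= eqxx; apply: (@cat_subseq _ [:: _] [:: _; _]).
    by rewrite sub1seq.
  by rewrite /= eqxx sub1seq.
exists c => //; apply/existsP.
case: (ltnP n (size c)) => [ltn|len]; first by exists (Ordinal ltn).
have c_gt0 : (0 < size c)%N by case: (c) m12 => // -[].
exists (Ordinal c_gt0); rewrite /= rot0.
by rewrite rot_oversize ?size_map in sub.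
Qed.

(** The function [x] is the indicator of the edges of one of the two arcs into
    which [v] cuts its circuit of [C].  One passes between the arcs only at [v];
    and each of the two visits to another vertex belongs to a single arc, the
    two visits being in different arcs exactly in the interlaced case. *)
Lemma arc_indicator v : exists x : halfedge F -> bool,
  [/\ forall h, x (opp h) = x h,
      forall c h, c \in C -> h \in c ->
        x (next c h) = x h (+) (inc (next c h) == v)
    & forall a b, a \in flatten C -> b \in flatten C -> a != b -> inc b = inc a ->
        x a (+) x b = (inc a == v) || interlaced C v (inc a)].
Proof.
have [c0 [n [h1 [h2 [s1 [s2 [cC ec [h1v h2v] [vs1 vs2] c0v]]]]]]] := arcs v.
have Uc := uniq_partition hP cC.
have Ur : uniq (h1 :: s1 ++ h2 :: s2) by rewrite -ec rot_uniq.
have mc0 a : (a \in c0) = (a \in (h1 :: s1) ++ h2 :: s2).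
  by rewrite -(mem_rot n) ec.
have c0D a : a \in c0 -> a \in flatten C by move=> ac; apply/flattenP; exists c0.
have v1 a : a \in s1 -> inc a != v.
  by move=> as1; apply: contraNneq vs1 => <-; exact: map_f.
have v2 a : a \in s2 -> inc a != v.
  by move=> as2; apply: contraNneq vs2 => <-; exact: map_f.
pose S := h1 :: s1.
have Sc a : a \in S -> a \in c0 by move=> aS; rewrite mc0 mem_cat aS.
have notS a : a \in h2 :: s2 -> (a \in S) = false.
  move: Ur; rewrite -cat_cons cat_uniq => /and3P[_ /hasPn dis _] as2.
  exact/negbTE/dis.
pose x a := edge a \in map (@edge F) S.
have xD a : a \in flatten C -> x a = (a \in S).
  move=> aD; rewrite /x mem_map_edge; case: (a \in S) => //=.
  by apply: contraTF aD => /Sc/c0D; rewrite opp_flatten.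
exists x; split=> [a|c a cC' ac|a b aD bD nab ab].
- by rewrite /x edge_opp.
- have aD : a \in flatten C by apply/flattenP; exists c.
  have nD : next c a \in flatten C by apply/flattenP; exists c; rewrite ?mem_next.
  have same b : b \in c -> b \in c0 -> c = c0.
    by move=> bc bc0; exact: (uniq_flatten_inj (uniq_flatten_partition hP) cC' cC bc bc0).
  rewrite !xD //; case: (boolP (a \in c0)) => [ac0|nac0]; last first.
    have nc0 b : b \in c -> b \notin c0.
      by move=> bc; apply: contraNN nac0 => bc0; rewrite -(same b).
    have nS b : b \in c -> (b \in S) = false.
      by move=> bc; apply: contraNF (nc0 b bc); exact: Sc.
    rewrite !nS ?mem_next //=; apply/esym/eqP => nv.
    have : next c a \notin c0 by rewrite nc0 ?mem_next.
    by case: (c0v _ nD nv) => ->; rewrite mc0 mem_cat !inE eqxx ?orbT.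
  rewrite (same _ ac ac0) -(next_rot n Uc) ec.
  (* This relation encodes the claim for consecutive half-edges. *)
  pose e a b := (b \in S) == ((a \in S) (+) (inc b == v)).
  suff cyc: cycle e (h1 :: s1 ++ h2 :: s2).
    by apply/eqP; apply: (next_cycle cyc); rewrite -ec mem_rot.
  rewrite /= rcons_cat cat_path /= rcons_path; apply/and4P; split.
  + apply: path_all_rel => i j iS js; rewrite /e (negPf (v1 _ js)) iS.
    by rewrite inE js orbT.
  + by rewrite /e h2v eqxx notS ?mem_head // (mem_last h1 s1 : _ \in S).
  + apply: path_all_rel => i j is2 js2; rewrite /e (negPf (v2 _ js2)) !notS //.
    by rewrite inE js2 orbT.
  + by rewrite /e h1v eqxx mem_head notS ?mem_last.
case: (eqVneq (inc a) v) => [av|nav] /=.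
  have h2S : h2 \in S = false by rewrite notS ?mem_head.
  have h1S : h1 \in S by rewrite mem_head.
  move: nab; rewrite !xD //.
  case: (c0v a aD av) (c0v b bD (etrans ab av)) => -> [->|->];
    by rewrite ?eqxx ?h1S ?h2S.
rewrite !xD // (interlaced_arcs cC ec) // 1?eq_sym //.
have sub12 i : i \in s1 ++ s2 -> i \in flatten C.
  move=> i12; rewrite c0D // mc0 mem_cat !inE orbACA -mem_cat i12.
  by rewrite orbT.
have arc i j : i \in c0 -> inc i = inc a -> inc j = inc a -> i \in S -> j \notin S ->
  j \in flatten C -> i \in s1 /\ j \in s2.
  move=> ic0 ia ja; rewrite inE; case: eqP => [ih|_ /= is1].
    by rewrite -ia ih h1v eqxx in nav.
  move=> jS jD; split=> //; have : j \in c0.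
    rewrite -mem_edge_circuit // (euler_incident cC (etrans ja (esym ia))).
    by rewrite mem_edge_circuit ?c0D.
  rewrite mc0 mem_cat (negPf jS) inE /=; case/predU1P=> // jh.
  by rewrite -ja jh h2v eqxx in nav.
apply/idP/andP => [|[/mapP[i is1 ia] /mapP[j js2 ja]]].
  case: (boolP (a \in S)) (boolP (b \in S)) => [aS|aS] [bS|bS] //= _.
    have [a1 b2] := arc a b (Sc _ aS) erefl ab aS bS bD.
    by rewrite map_f // -ab map_f.
  have [b1 a2] := arc b a (Sc _ bS) ab erefl bS aS aD.
  by rewrite -{1}ab !map_f.
have iS : i \in S by rewrite inE is1 orbT.
have jS : (j \in S) = false by rewrite notS // inE js2 orbT.
have iD : i \in flatten C by rewrite sub12 // mem_cat is1.
have jD : j \in flatten C by rewrite sub12 // mem_cat js2 orbT.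
case: (outgoing_two aD bD iD nab ab (esym ia)) iS => -> {}iS;
  case: (outgoing_two aD bD jD nab ab (esym ja)) jS => -> {}jS;
  by move: iS; rewrite jS // => ->.
Qed.

Lemma psi_transition_eq P p w : circuit_partition P ->
  p \in transition P w -> p \in psi_transition C w ->
  transition P w = psi_transition C w.
Proof.
move=> hQ pP; rewrite (transition_pair hQ (hF w) pP) /psi_transition.
have inD : half_at w :\: incoming C w = outgoing C w.
  by apply/setP => i; rewrite !inE opp_flatten //; case: (_ == w); case: (_ \in _).
have outD : half_at w :\: outgoing C w = incoming C w.
  by apply/setP => i; rewrite !inE opp_flatten //; case: (_ == w); case: (_ \in _).
by case/set2P=> ->; rewrite ?inD // outD setUC.
Qed.

(** The jump of [x] depends only on the pair of half-edges by which [P] passes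
    through [w], and [arc_indicator] gives it for each of the six pairs of
    half-edges at [w], two for each of the labels phi, psi and chi. *)
Lemma arc_jump v : exists x : halfedge F -> 'F_2,
  (forall h, x (opp h) = x h) /\
  forall P c h, circuit_partition P -> c \in P -> h \in c ->
    x h + x (next c h) =
    modified_interlacement_mx C P (enum_rank v) (enum_rank (inc (next c h))).
Proof.
have [x [xo xn xout]] := arc_indicator v.
exists (fun h => (x h)%:R); split=> [h|P c h hQ cP hc]; first by rewrite xo.
have addF2 (s t : bool) : s%:R + t%:R = (s (+) t)%:R :> 'F_2.
  by apply/val_inj; case: s; case: t.
rewrite addF2 -(xo h); set w := inc _.
have pP : [set opp h; next c h] \in transition P w.
  by apply/transitionP; exists c, h.
(* As a function of the unordered pair, the jump can be compared with [C]. *)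
pose sigma (p : {set halfedge F}) := \big[addb/false]_(i in p) x i.
have sigma2 k l : k != l -> sigma [set k; l] = x k (+) x l.
  by move=> kl; rewrite /sigma big_setU1 ?inE //= big_set1.
rewrite -sigma2 ?(passage_neq hQ cP hc) //.
have [c0 [h1 [h2 [cC hc1 hc2 n12 [eH eT eI eO]]]]] := passages w.
have aD l : l \in c0 -> next c0 l \in flatten C.
  by move=> lc; apply: next_flatten lc.
have aw l : l \in c0 -> opp l \in half_at w -> inc (next c0 l) = w.
  by move=> lc; rewrite inE (inc_next hP cC lc) => /eqP.
have a1w : inc (next c0 h1) = w by apply: aw; rewrite // eH !inE eqxx.
have a2w : inc (next c0 h2) = w by apply: aw; rewrite // eH !inE eqxx !orbT.
have na12 : next c0 h1 != next c0 h2.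
  by rewrite (can_eq (prev_next (uniq_partition hP cC))).
have x1 := xn _ _ cC hc1; have x2 := xn _ _ cC hc2.
have x12 := xout _ _ (aD _ hc1) (aD _ hc2) na12 (etrans a2w (esym a1w)).
rewrite a1w in x1 x12; rewrite a2w in x2.
have Ivv : w = v -> interlaced C v w = false by move=> ->; rewrite /interlaced eqxx.
have o12 : opp h1 != opp h2 by rewrite (can_eq (@oppK F)).
have ph1 := passage_neq hP cC hc1; have ph2 := passage_neq hP cC hc2.
rewrite !mxE !enum_rankK /phi_transition (inj_eq enum_rank_inj) (eq_sym v).
move: [set opp h; _] pP => p pP.
case: eqVneq => [ephi|nphi].
  by move: pP; rewrite ephi eT => /set2P[]->; rewrite sigma2 // xo ?x1 ?x2 addKb.
case: eqVneq => [epsi|npsi] /=.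
  have -> : sigma p = (w == v) || interlaced C v w.
    move: pP; rewrite epsi => /set2P[]->; rewrite ?eI ?eO sigma2 //.
    rewrite !xo -x12 x1 x2; case: (x h1) (x h2) (w == v) => [] [] [] //.
  by case: eqP.
have Npphi : p \notin transition C w.
  apply: contra nphi => pC; apply/eqP; exact: transition_eq pP pC.
have Nppsi : p \notin psi_transition C w.
  by apply: contra npsi => pC; apply/eqP; exact: psi_transition_eq pP pC.
have /eqP/cards2P[k [l [nkl ep]]] := card_transition hQ pP.
have := transition_sub hQ pP.
move: Npphi Nppsi; rewrite eT /psi_transition eI eO ep sigma2 // => Npphi Nppsi.
rewrite subUset !sub1set eH !in_setU !in_set1.
have no y z : [set y; z] != [set k; l] -> ~ (k = y /\ l = z \/ k = z /\ l = y).
  by move/eqP=> yz [] [ky lz]; apply: yz; rewrite ky lz // setUC.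
move: Npphi Nppsi; rewrite !in_set2 !negb_or.
rewrite 4!(eq_sym [set k; l]) => /andP[/no f1 /no f2] /andP[/no p1 /no p2].
(* What remains is the chi transition, whose pairs leave by the other passage. *)
have e1 : x h1 (+) x (next c0 h2) = interlaced C v w.
  move: x12 Ivv; rewrite x1 x2; case: eqP => [wv|_] + Ivv.
    by rewrite Ivv // !addbT; case: (x h1) (x h2) => [] [].
  by rewrite !addbF.
have e2 : x h2 (+) x (next c0 h1) = interlaced C v w.
  by rewrite -e1 x1 x2 !addbA (addbC (x h2)).
(* The 16 choices of [k] and [l] among the four half-edges at [w]: equal ones,
   phi pairs and psi pairs are excluded, chi pairs are given by e1 and e2. *)
case/andP=> /orP[]/orP[]/eqP kk /orP[]/orP[]/eqP ll;
  first [ by case/eqP: nkl; rewrite kk ll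
        | by case: f1; by [left | right] | by case: f2; by [left | right]
        | by case: p1; by [left | right] | by case: p2; by [left | right]
        | by rewrite kk ll xo ?e1 ?e2 | by rewrite kk ll addbC xo ?e1 ?e2 ].
Qed.

(** A function without jumps is constant on each circuit of [C], and all the
    edges at a vertex belong to a single circuit of [C]. *)
Lemma no_jump_constant (T : eqType) (z : halfedge F -> T) :
  (forall h, z (opp h) = z h) ->
  (forall c h, c \in C -> h \in c -> z (next c h) = z h) ->
  forall h k, inc h = inc k -> z h = z k.
Proof.
move=> zo zn.
have zc c h k : c \in C -> h \in c -> k \in c -> z k = z h.
  move=> cC hc; have Uc := uniq_partition hP cC.
  have eqz_trans: transitive (fun a b => z b == z a).
    by move=> b a d /eqP<- /eqP->.
  have : cycle (fun a b => z b == z a) c.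
    by apply: (cycle_from_next Uc) => a ac; apply/eqP; exact: zn.
  case/rot_to: hc => n s ec; rewrite -(mem_rot n) -(rot_cycle n) ec /=.
  move/(order_path_min eqz_trans)/allP => zs; rewrite inE => /predU1P[-> //|ks].
  by apply/eqP/zs; rewrite mem_rcons inE ks orbT.
have rep l : exists2 l', l' \in flatten C & z l' = z l /\ edge l' = edge l.
  case: (boolP (l \in flatten C)) => [lD|]; first by exists l.
  by rewrite -(opp_flatten hP) => olD; exists (opp l); rewrite ?zo ?edge_opp.
move=> h k hk; have [h' hD [<- eh]] := rep h; have [k' kD [<- ek]] := rep k.
case/flattenP: (hD) => d dC hd; apply: (zc d) => //.
by rewrite -mem_edge_circuit // ek -(euler_incident dC hk) -eh mem_edge_circuit.
Qed.

Lemma modified_interlacement_mx_id : modified_interlacement_mx C C = 1%:M.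
Proof. by apply/matrixP => i j; rewrite !mxE /phi_transition eqxx. Qed.

End EulerSystem.

(** * Products of modified interlacement matrices *)

(** M(C, C') expresses the arcs of [C] through those of [C'], up to sets of
    edges of whole components; these have no jumps, so they do not affect the
    jumps along [P]. *)
Lemma modified_interlacement_mx_mul (F : multigraph) (hF : four_regular F)
    (C C' P : seq (seq (halfedge F))) :
  euler_system C -> euler_system C' -> circuit_partition P ->
  modified_interlacement_mx C C' *m modified_interlacement_mx C' P
    = modified_interlacement_mx C P.
Proof.
move=> hC hC' hQ; have hP' := euler_system_circuit_partition hC'.
have addxx (t : 'F_2) : t + t = 0 by apply: addrr_pchar2; exact: pchar_Fp.
have addxx_eq (s t : 'F_2) : s + t = 0 -> t = s.
  by move/(congr1 (+%R s)); rewrite addrA addxx add0r addr0.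
have /fin_all_exists[y yP] := arc_jump hF hC'.
apply/matrixP => i j; have [x [xo xj]] := arc_jump hF hC (enum_val i).
set M := modified_interlacement_mx C C'.
pose z h := x h + \sum_k M i k * y (enum_val k) h.
have zo h : z (opp h) = z h.
  rewrite /z xo; congr (_ + _); apply: eq_bigr => k _.
  by have [-> _] := yP (enum_val k).
have zj Q c h : circuit_partition Q -> c \in Q -> h \in c ->
  z h + z (next c h) =
  (modified_interlacement_mx C Q + M *m modified_interlacement_mx C' Q)
     i (enum_rank (inc (next c h))).
  move=> hR cQ hc; rewrite /z addrACA -big_split /= (xj Q) // enum_valK [RHS]mxE.
  congr (_ + _); rewrite [RHS]mxE; apply: eq_bigr => k _; rewrite -mulrDr.
  by congr (_ * _); have [_ /(_ Q)->] := yP (enum_val k); rewrite ?enum_valK.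
(* Over GF(2), the two terms cancel as M(C', C') = 1. *)
have zn c h : c \in C' -> h \in c -> z (next c h) = z h.
  move=> cC hc; apply: addxx_eq; rewrite (zj C') //.
  by rewrite modified_interlacement_mx_id mulmx1 mxE addxx.
have /set0Pn[l]: half_at (enum_val j) != set0.
  by rewrite -card_gt0 [#|_|](hF (enum_val j)).
rewrite inE => /eqP/(transition_cover hQ)[p /transitionP[c [h [cP hc hj _]]] _].
apply: addxx_eq; have := zj P c h hQ cP hc; rewrite hj enum_valK mxE => <-.
have -> : z (next c h) = z (opp h).
  exact: (no_jump_constant hC' zo zn) (inc_next hQ cP hc).
by rewrite zo addxx.
Qed.

Unset Implicit Arguments.

Theorem corollary9 (F : multigraph) (hF : four_regular F)
    (C C' : seq (seq (halfedge F)))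
    (hC : euler_system C) (hC' : euler_system C') :
  modified_interlacement_mx C' C \in unitmx /\
  modified_interlacement_mx C C' = invmx (modified_interlacement_mx C' C).
Proof.
have E : modified_interlacement_mx C C' *m modified_interlacement_mx C' C = 1%:M.
  rewrite modified_interlacement_mx_mul ?modified_interlacement_mx_id //.
  exact: euler_system_circuit_partition.
have [_ U] := mulmx1_unit E.
by split=> //; rewrite -[LHS]mulmx1 -(mulmxV U) mulmxA E mul1mx.
Qed.
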